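(* Let $P=P^X$ be a probability measure over $\mathbb{R}^k$ and fix $\theta\in\mathbb{R}^k$. Let $t_{\theta,P}=\sup_{u\in\mathcal{S}^{k-1}}\mathrm{pr}\{u^T(X-\theta)=0\}$, and let $R_\theta(\alpha,P)=\{V\in\mathcal{P}_{k,\mathrm{tr}}: D_\theta(V,P)\geq\alpha\}$. (i) If $R_\theta(t_{\theta,P},P)$ is non-empty, then there exists a shape matrix $V_*\in\mathcal{P}_{k,\mathrm{tr}}$ maximizing $V\mapsto D_\theta(V,P)$ over $\mathcal{P}_{k,\mathrm{tr}}$. (ii) In particular, if $P$ is smooth at $\theta$, that is, if $t_{\theta,P}=0$, then such a deepest shape $V_*$ exists.
   Context: $P=P^X$ denotes the distribution of a random $k$-vector $X$, and $\mathrm{pr}$ denotes probability under $P$. $\mathcal{P}_k$ is the set of $k\times k$ real symmetric positive definite matrices, $A^{1/2}$ is the unique square root of $A\in\mathcal{P}_k$ in $\mathcal{P}_k$, $A^{-1/2}$ is the inverse of $A^{1/2}$, and $\mathcal{P}_{k,\mathrm{tr}}=\{V\in\mathcal{P}_k:\mathrm{tr}(V)=k\}$ is the set of shape matrices. $\mathcal{S}^{m-1}$ is the unit sphere of $\mathbb{R}^m$. For $V\in\mathcal{P}_{k,\mathrm{tr}}$, let $U_{\theta,V}=V^{-1/2}(X-\theta)/\|V^{-1/2}(X-\theta)\|$ if $X\neq\theta$ and $U_{\theta,V}=0$ otherwise, and let $W_{\theta,V}=\mathrm{vec}\{U_{\theta,V}U_{\theta,V}^T-(1/k)I_k\}\in\mathbb{R}^{k^2}$,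 where $\mathrm{vec}$ stacks the columns of a matrix. The fixed-$\theta$ (Tyler) shape depth of $V$ with respect to $P$ is $$D_\theta(V,P)=\inf_{u\in\mathcal{S}^{k^2-1}}\mathrm{pr}(u^T W_{\theta,V}\geq 0).$$ *)

(* Defs.v *)
From HB Require Import structures.
From mathcomp Require Import all_boot all_order all_algebra.
From mathcomp Require Import all_classical all_reals all_analysis.
Import numFieldNormedType.Exports.

Set Implicit Arguments.
Unset Strict Implicit.
Unset Printing Implicit Defensive.

Import Order.TTheory GRing.Theory Num.Theory.

Local Open Scope classical_set_scope.
Local Open Scope ring_scope.

(* R^k with its Borel sigma-algebra, the one generated by the open sets of the
   library's (product) topology on column vectors. *)
Notation borelcV R k := (g_sigma_algebraType (@open 'cV[R]_k)).

Definition dotcV (R : realType) (m : nat) (u v : 'cV[R]_m) : R :=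
  (u^T *m v) 0 0.

(* The Euclidean norm; the library norm on matrices is the sup norm. *)
Definition enorm (R : realType) (m : nat) (u : 'cV[R]_m) : R :=
  Num.sqrt (dotcV u u).

(* The unit sphere of R^m, i.e. S^(m-1). *)
Definition usphere (R : realType) (m : nat) : set 'cV[R]_m :=
  [set u | enorm u = 1].

Definition posdefmx (R : realType) (k : nat) : set 'M[R]_k :=
  [set A | A^T = A /\ forall x : 'cV[R]_k, x != 0 -> 0 < dotcV x (A *m x)].

Definition shapemx (R : realType) (k : nat) : set 'M[R]_k :=
  [set V | posdefmx V /\ \tr V = k%:R].

(* The unique positive definite B such that B *m B = A when A is positive
   definite; the default value 0 is irrelevant in that case. *)
Definition sqrtmx (R : realType) (k : nat) (A : 'M[R]_k) : 'M[R]_k :=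
  xget 0 [set B | posdefmx B /\ B *m B = A].

(* mxvec reads a matrix row by row, hence the transposition. *)
Definition vec (R : realType) (m n : nat) (A : 'M[R]_(m, n)) : 'cV[R]_(n * m) :=
  (mxvec A^T)^T.

Definition signU (R : realType) (k : nat) (theta : 'cV[R]_k) (V : 'M[R]_k)
    (x : 'cV[R]_k) : 'cV[R]_k :=
  if x == theta then 0
  else let y := invmx (sqrtmx V) *m (x - theta) in (enorm y)^-1 *: y.

Definition scoreW (R : realType) (k : nat) (theta : 'cV[R]_k) (V : 'M[R]_k)
    (x : 'cV[R]_k) : 'cV[R]_(k * k) :=
  let U := signU theta V x in vec (U *m U^T - (k%:R^-1)%:M).

Definition shape_depth (R : realType) (k : nat) (theta : 'cV[R]_k)
    (V : 'M[R]_k) (P : probability (borelcV R k) R) : \bar R :=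
  ereal_inf [set P [set x : 'cV[R]_k | 0 <= dotcV u (scoreW theta V x)]
            | u in @usphere R (k * k)].

Definition hyperplane_mass (R : realType) (k : nat) (theta : 'cV[R]_k)
    (P : probability (borelcV R k) R) : \bar R :=
  ereal_sup [set P [set x : 'cV[R]_k | dotcV u (x - theta) = 0]
            | u in @usphere R k].

Definition depth_region (R : realType) (k : nat) (theta : 'cV[R]_k)
    (alpha : \bar R) (P : probability (borelcV R k) R) : set 'M[R]_k :=
  [set V | shapemx V /\ (alpha <= shape_depth theta V P)%E].

Definition smooth_at (R : realType) (k : nat) (theta : 'cV[R]_k)
    (P : probability (borelcV R k) R) : Prop :=
  hyperplane_mass theta P = 0%E.

Definition deepest_shape (R : realType) (k : nat) (theta : 'cV[R]_k)
    (P : probability (borelcV R k) R) (V : 'M[R]_k) : Prop :=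
  shapemx V /\
  forall V', shapemx V' -> (shape_depth theta V' P <= shape_depth theta V P)%E.

(* Main.v *)
Require Import Defs.
From HB Require Import structures.
From mathcomp Require Import all_boot all_order all_algebra.
From mathcomp Require Import all_classical all_reals all_analysis.
From mathcomp.real_closed Require Import complex.
From mathcomp Require Import lra.
Import numFieldNormedType.Exports.

Set Implicit Arguments.
Unset Strict Implicit.
Unset Printing Implicit Defensive.

Import Order.TTheory GRing.Theory Num.Theory.

Local Open Scope classical_set_scope.
Local Open Scope ring_scope.

(** The depth is first rewritten without square roots. Let [B] be the positive
    definite square root of [V] and let [u] be the vectorization of [M]. For
    [x <> theta] the sign of [u^T W] is that of [y^T N y], where
    [y = B^-1 (x - theta)] and [N] is the traceless part of [M]; with
    [S = B^-1 N B^-1] this is the sign of [(x - theta)^T S (x - theta)], and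
    [tr N = 0] becomes [tr (S V) = 0]. The point [theta] itself can always be
    excluded by adding a positive multiple of the identity to [M]. Hence
    ([shape_depthE]) the depth of [V] is the infimum, over the matrices [S] with
    [tr (S V) = 0], of the mass of the cone
    [{x <> theta | 0 <= (x - theta)^T S (x - theta)}]. This last expression,
    [cone_depth], makes sense for every matrix [V], in particular for singular
    positive semidefinite ones.

    On matrices of trace [k], [cone_depth] is upper semicontinuous
    ([cone_depth_usc]): if [tr (S V) = 0] and [V'] is close to [V], then
    [S - (tr (S V') / k) I] is admissible for [V'] and its cone lies in that of
    [S + e I], whose mass is close to that of the cone of [S] by continuity from
    above. The positive semidefinite matrices of trace [k] form a compact set
    ([compact_psdshapemx]), so [cone_depth] attains its maximum there
    ([usc_compact_max]), at [V0] say.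

    If [V0] is positive definite, it is a deepest shape. Otherwise [v^T V0 v = 0]
    for some unit vector [v], the matrix [S = - v v^T] is admissible, and its
    cone lies in the hyperplane through [theta] orthogonal to [v]; hence the
    maximum is at most the hyperplane mass ([cone_depth_singular]). Every shape
    matrix in the region at that level is then a deepest shape.

    The definition of the depth chooses a square root, which must be shown to
    exist ([posdefmx_sqrt]). By the spectral theorem over [R[i]], a polynomial
    that vanishes on the spectrum of a symmetric matrix [A] annihilates [A];
    interpolating the fourth root on the spectrum by a real polynomial [q] gives
    the square root [q(A)^2], which is positive definite because [q(A)] is
    symmetric and invertible. *)

(** * The Euclidean inner product *)

Lemma dotcVE (R : realType) (m : nat) (u v : 'cV[R]_m) :
  dotcV u v = \sum_i u i 0 * v i 0.
Proof. by rewrite /dotcV mxE; apply: eq_bigr => i _; rewrite mxE. Qed.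

Lemma dotcVC (R : realType) (m : nat) (u v : 'cV[R]_m) :
  dotcV u v = dotcV v u.
Proof. by rewrite !dotcVE; apply: eq_bigr => i _; rewrite mulrC. Qed.

Lemma dotcVDr (R : realType) (m : nat) (u v w : 'cV[R]_m) :
  dotcV u (v + w) = dotcV u v + dotcV u w.
Proof. by rewrite /dotcV mulmxDr mxE. Qed.

Lemma dotcVZr (R : realType) (m : nat) (a : R) (u v : 'cV[R]_m) :
  dotcV u (a *: v) = a * dotcV u v.
Proof. by rewrite /dotcV -scalemxAr mxE. Qed.

Lemma dotcVZl (R : realType) (m : nat) (a : R) (u v : 'cV[R]_m) :
  dotcV (a *: u) v = a * dotcV u v.
Proof. by rewrite dotcVC dotcVZr dotcVC. Qed.

Lemma dotcVDl (R : realType) (m : nat) (u v w : 'cV[R]_m) :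
  dotcV (v + w) u = dotcV v u + dotcV w u.
Proof. by rewrite dotcVC dotcVDr !(dotcVC u). Qed.

Lemma dotcV0r (R : realType) (m : nat) (u : 'cV[R]_m) : dotcV u 0 = 0.
Proof. by rewrite /dotcV mulmx0 mxE. Qed.

Lemma dotcV_mulmxl (R : realType) (m n : nat) (A : 'M[R]_(m, n)) u v :
  dotcV (A *m u) v = dotcV u (A^T *m v).
Proof. by rewrite /dotcV trmx_mul mulmxA. Qed.

Lemma dotcV_ge0 (R : realType) (m : nat) (u : 'cV[R]_m) : 0 <= dotcV u u.
Proof. by rewrite dotcVE sumr_ge0// => i _; rewrite -expr2 sqr_ge0. Qed.

Lemma dotcV_eq0 (R : realType) (m : nat) (u : 'cV[R]_m) :
  (dotcV u u == 0) = (u == 0).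
Proof.
apply/idP/eqP => [|->]; last by rewrite dotcV0r.
rewrite dotcVE psumr_eq0 => [/allP u0|i _]; last by rewrite -expr2 sqr_ge0.
apply/colP => i; have := u0 i (mem_index_enum i).
by rewrite -expr2 sqrf_eq0 mxE => /eqP.
Qed.

Lemma dotcV_gt0 (R : realType) (m : nat) (u : 'cV[R]_m) :
  u != 0 -> 0 < dotcV u u.
Proof. by move=> u0; rewrite lt_neqAle dotcV_ge0 eq_sym dotcV_eq0 u0. Qed.

Lemma sqr_enorm (R : realType) (m : nat) (u : 'cV[R]_m) :
  enorm u ^+ 2 = dotcV u u.
Proof. by rewrite sqr_sqrtr// dotcV_ge0. Qed.

Lemma enorm_gt0 (R : realType) (m : nat) (u : 'cV[R]_m) :
  u != 0 -> 0 < enorm u.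
Proof. by move=> u0; rewrite sqrtr_gt0 dotcV_gt0. Qed.

Lemma enorm_normalize (R : realType) (m : nat) (u : 'cV[R]_m) :
  u != 0 -> enorm ((enorm u)^-1 *: u) = 1.
Proof.
move=> /enorm_gt0 u0; rewrite {1}/enorm dotcVZl dotcVZr -sqr_enorm mulrA -expr2.
by rewrite -exprMn mulVf ?expr1n ?sqrtr1// gt_eqF.
Qed.

(** * Square roots of positive definite matrices *)

Lemma posdefmx_unit (R : realType) (k : nat) (A : 'M[R]_k) :
  posdefmx A -> A \in unitmx.
Proof.
move=> [symA posA]; rewrite unitmxE unitfE; apply/negP => /det0P[v v0 vA].
have /posA : v^T != 0 by rewrite trmx_eq0.
by rewrite -symA -trmx_mul vA trmx0 dotcV0r ltxx.
Qed.

Lemma poly_interpolation (F : fieldType) (s : seq F) (f : F -> F) :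
  exists p : {poly F}, forall x, x \in s -> p.[x] = f x.
Proof.
elim: s => [|a s [p ps]]; first by exists 0.
have [sa|sa] := boolP (a \in s).
  by exists p => x; rewrite inE => /orP[/eqP ->|]; apply: ps.
pose q := \prod_(b <- s) ('X - b%:P).
have qa : q.[a] != 0 by rewrite -rootE root_prod_XsubC.
exists (p + ((f a - p.[a]) / q.[a])%:P * q) => x; rewrite !hornerE inE.
have [->|_ /= xs] := eqVneq x a; first by rewrite divfK// addrC subrK.
have /eqP -> : root q x by rewrite root_prod_XsubC.
by rewrite mulr0 addr0 ps.
Qed.

Lemma trmx_horner_mx (F : fieldType) (n : nat) (A : 'M[F]_n.+1) (p : {poly F}) :
  A^T = A -> (horner_mx A p)^T = horner_mx A p.
Proof.
move=> symA; elim/poly_ind: p => [|p c IH]; first by rewrite rmorph0 trmx0.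
rewrite rmorphD rmorphM /= horner_mx_X horner_mx_C raddfD /= tr_scalar_mx.
congr (_ + _); rewrite -mulmxE trmx_mul IH symA.
by apply: comm_mx_horner.
Qed.

(** Here [s] lists the spectrum of [A]. *)
Lemma posdefmx_spectrum (R : realType) (n : nat) (A : 'M[R]_n.+1) :
  posdefmx A ->
  exists s : seq R, (forall a, a \in s -> 0 <= a) /\
    forall p : {poly R}, (forall a, a \in s -> p.[a] = 0) -> horner_mx A p = 0.
Proof.
move=> [symA posA].
pose f : {rmorphism R -> R[i]} := real_complex R.
pose Ac := map_mx f A.
have hermAc : Ac \is hermsymmx.
  apply/is_hermitianmxP; rewrite expr0 scale1r.
  apply/matrixP => i j; rewrite !mxE -[in LHS]symA mxE.
  exact/esym/conjc_real.
have /hermitian_normalmx/orthomx_spectralP AcE := hermAc.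
have spR := hermitian_spectral_diag_real hermAc.
set Q := spectralmx Ac in AcE; set d := spectral_diag Ac in AcE spR.
have Qu : Q \is a GRing.unit by exact: spectral_unit.
pose l i := complex.Re (d 0 i).
have dE i : d 0 i = f (l i).
  have : d 0 i \is Num.real by apply: (mxOverP spR).
  by rewrite /l; case: (d 0 i) => a b /complex_realP[x []] -> ->.
exists [seq l i | i : 'I_n.+1]; split=> [a /mapP[i _ ->]|p p0].
- (* A complex eigenvector of [A] yields a real one, because being an
     eigenvalue only depends on the characteristic polynomial. *)
  have : eigenvalue A (l i).
    rewrite -(eigenvalue_map f) -dE; apply/eigenvalueP.
    exists (row i Q); last first.
      apply/eqP => /(congr1 (mulmx^~ (invmx Q))).
      rewrite mul0mx rowE mulmxK// => /rowP/(_ i); rewrite !mxE !eqxx => /eqP.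
      by rewrite oner_eq0.
    rewrite -row_mul -[map_mx _ _]/Ac AcE -mulmxA mulKVmx// mul_diag_mx.
    by apply/rowP => j; rewrite !mxE.
  move=> /eigenvalueP[v vA v0].
  have /posA : v^T != 0 by rewrite trmx_eq0.
  rewrite -symA -trmx_mul vA linearZ dotcVZr pmulr_lgt0 => [/ltW//|].
  by rewrite dotcV_gt0// trmx_eq0.
- apply: (@map_mx_inj _ _ f); rewrite map_mx0 map_horner_mx -/Ac AcE.
  rewrite (horner_mx_uconjC _ _ Qu) horner_mx_diag.
  suff -> : map_mx (horner (map_poly f p)) d = 0.
    by rewrite raddf0 mulmx0 mul0mx.
  apply/rowP => i; rewrite !mxE dE horner_map p0 ?rmorph0//.
  by apply: map_f; rewrite mem_enum.
Qed.

Lemma posdefmx_sqrt (R : realType) (k : nat) (A : 'M[R]_k) :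
  posdefmx A -> exists B : 'M[R]_k, posdefmx B /\ B *m B = A.
Proof.
case: k A => [A _|n A posA].
  exists 0; split; last by apply/matrixP => -[].
  split=> [|x]; first by rewrite trmx0.
  by rewrite (_ : x = 0) ?eqxx//; apply/colP => -[].
have [s [s0 sA]] := posdefmx_spectrum posA.
have [q qE] := poly_interpolation s (fun a => Num.sqrt (Num.sqrt a)).
pose C := horner_mx A q; have symC : C^T = C by apply: trmx_horner_mx; case: posA.
have CA : C *m C *m (C *m C) = A.
  rewrite !mulmxE -!expr2 -exprM -rmorphXn/= -[RHS](horner_mx_X A).
  apply/eqP; rewrite -subr_eq0 -rmorphB/=; apply/eqP/sA => a sa.
  by rewrite !hornerE qE// (exprM _ 2 2) !sqr_sqrtr ?sqrtr_ge0 ?subrr// s0.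
exists (C *m C); split=> //; split=> [|x x0]; first by rewrite trmx_mul symC.
rewrite -mulmxA -{1}symC -dotcV_mulmxl dotcV_gt0//.
apply/eqP => Cx0; have := posA.2 x x0.
by rewrite -CA -!mulmxA Cx0 !mulmx0 dotcV0r ltxx.
Qed.

Lemma sqrtmxP (R : realType) (k : nat) (A : 'M[R]_k) :
  posdefmx A -> posdefmx (sqrtmx A) /\ sqrtmx A *m sqrtmx A = A.
Proof. by move=> /posdefmx_sqrt; apply: xgetPex. Qed.

(** * Maxima of upper semicontinuous functions *)

(** If no maximum existed, the strict sublevel sets at the values of [f] on [K]
    would cover [K]; they are open in [K] and totally ordered by inclusion, so
    one of them would contain [K], including the point that defines it. *)
Lemma usc_compact_max (R : realType) (T : topologicalType) (f : T -> \bar R)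
    (K : set T) :
  compact K -> K !=set0 ->
  (forall x a, K x -> (f x < a)%E ->
    \forall y \near x, K y -> (f y < a)%E) ->
  exists2 x, K x & forall y, K y -> (f y <= f x)%E.
Proof.
move=> cK [x0 Kx0] usc; apply: contrapT => nomax.
have above x : K x -> exists2 y, K y & (f x < f y)%E.
  move=> Kx; apply: contrapT => nox; apply: nomax; exists x => // y Ky.
  by rewrite leNgt; apply/negP => fxy; apply: nox; exists y.
(* The filter on [K] generated by the superlevel sets at the values of [f]. *)
pose F := filter_from K (fun y => [set z | K z /\ (f y <= f z)%E]).
have FF : Filter F.
  apply: filter_from_filter; first by exists x0.
  move=> y z Ky Kz; have [fyz|/ltW fzy] := leP (f y) (f z).
    by exists z => // t [Kt fzt]; do !split=> //; apply: le_trans fzt.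
  by exists y => // t [Kt fyt]; do !split=> //; apply: le_trans fyt.
have /compact_near_coveringP cover := cK.
have [x Kx|y Ky sub] := cover _ F (fun z x => K x -> (f x < f z)%E) FF.
  have [y Ky fxy] := above x Kx.
  exists ([set x' | K x' -> (f x' < f y)%E], [set z | K z /\ (f y <= f z)%E]).
    by split; [exact: usc|exists y].
  by move=> [x' z] [/= fx'y [_ fyz]] /fx'y /lt_le_trans; apply.
by have := sub y (conj Ky (lexx _)) y Ky Ky; rewrite ltxx.
Qed.

(** * Continuity of matrix expressions *)

Lemma continuous_dotcV (R : realType) (T : topologicalType) (m : nat)
    (f g : T -> 'cV[R]_m) :
  (forall i, continuous (fun x => f x i 0)) ->
  (forall i, continuous (fun x => g x i 0)) ->
  continuous (fun x => dotcV (f x) (g x)).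
Proof.
move=> cf cg; under eq_fun do rewrite dotcVE.
apply: continuous_big => [|i _].
  exact: add_continuous.
by move=> x; apply: cvgM; [apply: cf|apply: cg].
Qed.

Lemma continuous_mulmxl (R : realType) (T : topologicalType) (m n p : nat)
    (A : 'M[R]_(m, n)) (f : T -> 'M[R]_(n, p)) :
  (forall i j, continuous (fun x => f x i j)) ->
  forall i j, continuous (fun x => (A *m f x) i j).
Proof.
move=> cf i j; under eq_fun do rewrite mxE.
apply: continuous_big => [|l _]; first exact: add_continuous.
by move=> x; apply: cvgMr; apply: cf.
Qed.

Lemma continuous_mulmxr (R : realType) (T : topologicalType) (m n p : nat)
    (A : 'M[R]_(n, p)) (f : T -> 'M[R]_(m, n)) :
  (forall i j, continuous (fun x => f x i j)) ->
  forall i j, continuous (fun x => (f x *m A) i j).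
Proof.
move=> cf i j; under eq_fun do rewrite mxE.
apply: continuous_big => [|l _]; first exact: add_continuous.
by move=> x; apply: cvgMl; apply: cf.
Qed.

Lemma continuous_mxtrace (R : realType) (T : topologicalType) (n : nat)
    (f : T -> 'M[R]_n) :
  (forall i j, continuous (fun x => f x i j)) ->
  continuous (fun x => \tr (f x)).
Proof.
move=> cf; apply: continuous_big => [|i _]; first exact: add_continuous.
exact: cf.
Qed.

Lemma continuous_vec_mx (R : realType) (m n : nat) :
  continuous (vec_mx : 'rV[R]_(m * n) -> 'M[R]_(m, n)).
Proof.
move=> v A /nbhs_ballP[e e0 eA]; apply/nbhs_ballP; exists e => // w [_ vw].
by apply: eA; split=> // i j; rewrite !mxE; apply: vw.
Qed.

(** * Compactness of the closed set of shapes *)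

(** Symmetric positive semidefinite matrices. *)
Definition psdmx (R : realType) (k : nat) : set 'M[R]_k :=
  [set A | A^T = A /\ forall x : 'cV[R]_k, 0 <= dotcV x (A *m x)].

(** Possibly singular shape matrices; this set is the closure of [shapemx]. *)
Definition psdshapemx (R : realType) (k : nat) : set 'M[R]_k :=
  [set V | psdmx V /\ \tr V = k%:R].

Lemma dotcV_delta (R : realType) (k : nat) (A : 'M[R]_k) i j :
  dotcV (delta_mx i 0) (A *m delta_mx j 0) = A i j.
Proof.
rewrite -colE dotcVE (bigD1 i)//= big1 ?addr0 => [|l li].
  by rewrite !mxE !eqxx mul1r.
by rewrite !mxE (negbTE li) mul0r.
Qed.

Lemma psdmx_entry_le (R : realType) (k : nat) (A : 'M[R]_k) i j :
  psdmx A -> `|A i j| <= \tr A.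
Proof.
move=> [symA psdA].
have diag_ge0 l : 0 <= A l l by rewrite -dotcV_delta.
have diag_le l : A l l <= \tr A.
  by rewrite /mxtrace (bigD1 l)//= lerDl sumr_ge0.
have Aji : A j i = A i j by rewrite -[in LHS]symA mxE.
have pair (c : R) : 0 <= A i i + c * A i j *+ 2 + c ^+ 2 * A j j.
  have := psdA (delta_mx i 0 + c *: delta_mx j 0).
  rewrite mulmxDr -scalemxAr !dotcVDl !dotcVDr !dotcVZl !dotcVZr !dotcV_delta Aji.
  lra.
have := pair 1; have := pair (-1); have := diag_le i; have := diag_le j.
rewrite ler_norml; lra.
Qed.

Lemma compact_psdshapemx (R : realType) (k : nat) :
  compact (@psdshapemx R k).
Proof.
have cc i j : continuous (fun V : 'M[R]_k => V i j) by exact: coord_continuous.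
have clsym : closed [set V : 'M[R]_k | V^T = V].
  rewrite (_ : [set _ | _] =
      \bigcap_(i in [set: 'I_k]) \bigcap_(j in [set: 'I_k])
        (fun V : 'M[R]_k => V i j - V j i) @^-1` [set x | x = 0]).
    apply: closed_bigI => i _; apply: closed_bigI => j _; apply: closed_comp.
      by move=> V _; exact: (cvgB (cc i j V) (cc j i V)).
    exact: closed_eq.
  apply/seteqP; split=> V /=.
    by move=> VT i _ j _ /=; rewrite -[in X in _ - X]VT mxE subrr.
  move=> VT; apply/matrixP => i j; rewrite mxE; apply/eqP.
  by rewrite -subr_eq0; apply/eqP/VT.
have clpos : closed [set V : 'M[R]_k | forall x : 'cV[R]_k, 0 <= dotcV x (V *m x)].
  rewrite (_ : [set _ | _] = \bigcap_(x in [set: 'cV[R]_k])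
      (fun V : 'M[R]_k => dotcV x (V *m x)) @^-1` [set a | 0 <= a]).
    apply: closed_bigI => x _; apply: closed_comp; last exact: closed_ge.
    move=> V _; apply: continuous_dotcV => i; first exact: cst_continuous.
    exact: continuous_mulmxr.
  by apply/seteqP; split=> V /= psdV => [x _|x]; apply: psdV.
have clK : closed (@psdshapemx R k).
  apply: closedI; first exact: closedI clsym clpos.
  apply: (@closed_comp _ _ (fun V : 'M[R]_k => \tr V) [set x | x = k%:R]).
    by move=> V _; apply: continuous_mxtrace.
  exact: closed_eq.
(* Bounded closed sets of row vectors are compact, and [vec_mx] is a
   continuous surjection from row vectors to matrices. *)
rewrite (_ : @psdshapemx R k = vec_mx @` (vec_mx @^-1` (@psdshapemx R k))).
  apply: continuous_compact.
    exact/continuous_subspaceT/continuous_vec_mx.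
  apply: bounded_closed_compact.
    exists k%:R; split; first exact: realn.
    move=> b kb v [psdv trv]; rewrite /= [`|v|]mx_normrE.
    apply: bigmax_le => [|[i l] _]; first by rewrite (le_trans _ (ltW kb)).
    rewrite (le_trans _ (ltW kb))// -trv ord1; case/mxvec_indexP: l => l j.
    have := psdmx_entry_le l j psdv.
    by rewrite mxE.
  by apply: closed_comp => // v _; apply: continuous_vec_mx.
apply/seteqP; split=> [V KV|_ [v Kv <-]//].
by exists (mxvec V); rewrite /= mxvecK.
Qed.

(** * Quadratic cones *)

(** The points other than [theta] at which the quadratic form of [S], centred at
    [theta], is nonnegative. The matrix [S] need not be symmetric. *)
Definition quad_cone (R : realType) (k : nat) (theta : 'cV[R]_k) (S : 'M[R]_k) :
    set 'cV[R]_k :=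
  [set x | x != theta /\ 0 <= dotcV (x - theta) (S *m (x - theta))].

(** The square-root-free expression of the depth. It is defined for every matrix
    [V], and agrees with [shape_depth] on shape matrices. *)
Definition cone_depth (R : realType) (k : nat) (theta : 'cV[R]_k)
    (P : probability (borelcV R k) R) (V : 'M[R]_k) : \bar R :=
  ereal_inf [set P (quad_cone theta S) | S in [set S | \tr (S *m V) = 0]].

Lemma dotcV_add_scalar (R : realType) (m : nat) (S : 'M[R]_m) (c : R) x :
  dotcV x ((S + c%:M) *m x) = dotcV x (S *m x) + c * dotcV x x.
Proof. by rewrite mulmxDl mul_scalar_mx dotcVDr dotcVZr. Qed.

Lemma quad_cone_le (R : realType) (k : nat) (theta : 'cV[R]_k) (S : 'M[R]_k)
    (a b : R) :
  a <= b -> quad_cone theta (S + a%:M) `<=` quad_cone theta (S + b%:M).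
Proof.
move=> ab x [xt Sx]; split=> //; apply: le_trans Sx _.
by rewrite !dotcV_add_scalar lerD2l ler_wpM2r ?dotcV_ge0.
Qed.

Lemma borelcV_open_measurable (R : realType) (k : nat) (A : set 'cV[R]_k) :
  open A -> measurable (A : set (borelcV R k)).
Proof. by move=> oA; apply: sub_sigma_algebra. Qed.

Lemma borelcV_closed_measurable (R : realType) (k : nat) (A : set 'cV[R]_k) :
  closed A -> measurable (A : set (borelcV R k)).
Proof.
move=> cA; rewrite -[A]setCK.
apply: (@measurableC _ (borelcV R k)); apply: borelcV_open_measurable.
exact: closed_openC.
Qed.

Lemma closed_singleton (R : realType) (k : nat) (theta : 'cV[R]_k) :
  closed [set theta].
Proof. exact/accessible_closed_set1/hausdorff_accessible/norm_hausdorff. Qed.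

Lemma continuous_subr_entry (R : realType) (k : nat) (theta : 'cV[R]_k) i j :
  continuous (fun x : 'cV[R]_k => (x - theta) i j).
Proof.
move=> x; under eq_fun do rewrite !mxE.
exact: (cvgB (@coord_continuous _ _ _ i j x) (cvg_cst _)).
Qed.

Lemma measurable_quad_cone (R : realType) (k : nat) (theta : 'cV[R]_k)
    (S : 'M[R]_k) :
  measurable (quad_cone theta S : set (borelcV R k)).
Proof.
rewrite (_ : quad_cone theta S = ~` [set theta] `&`
    (fun x => dotcV (x - theta) (S *m (x - theta))) @^-1` [set a | 0 <= a]).
  apply: (@measurableI _ (borelcV R k)).
    apply: (@measurableC _ (borelcV R k)).
    apply: (@borelcV_closed_measurable R k); exact: closed_singleton.
  apply: (@borelcV_closed_measurable R k); apply: closed_comp; last exact: closed_ge.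
  move=> x _; apply: continuous_dotcV => i; first exact: continuous_subr_entry.
  by apply: continuous_mulmxl; apply: continuous_subr_entry.
by apply/seteqP; split=> x [/eqP].
Qed.

Lemma measurable_hyperplane (R : realType) (k : nat) (theta u : 'cV[R]_k) :
  measurable ([set x | dotcV u (x - theta) = 0] : set (borelcV R k)).
Proof.
apply: (@borelcV_closed_measurable R k).
apply: (@closed_comp _ _ (fun x : 'cV[R]_k => dotcV u (x - theta)) [set a | a = 0]).
  move=> x _; apply: continuous_dotcV => i; first exact: cst_continuous.
  exact: continuous_subr_entry.
exact: closed_eq.
Qed.

(** Continuity from above: the cones of [S + n^-1 I] decrease to that of [S]. *)
Lemma quad_cone_perturb (R : realType) (k : nat) (theta : 'cV[R]_k)
    (P : probability (borelcV R k) R) (S : 'M[R]_k) (a : \bar R) :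
  (P (quad_cone theta S) < a)%E ->
  exists2 e : R, 0 < e & (P (quad_cone theta (S + e%:M)) < a)%E.
Proof.
move=> Sa; pose F (n : nat) : set (borelcV R k) :=
  quad_cone theta (S + (n.+1%:R^-1)%:M).
have capF : \bigcap_n F n = quad_cone theta S.
  apply/seteqP; split=> x.
    move=> Fx; have [xt _] := Fx 0%N I; split=> //.
    apply/ler_addgt0Pr => e e0.
    set d := dotcV (x - theta) (x - theta).
    have [n nd] : exists n : nat, n.+1%:R^-1 * d <= e.
      exists (Num.bound (d / e)); rewrite mulrC ler_pdivrMr// mulrC -ler_pdivrMr//.
      have /ltW := archi_boundP (divr_ge0 (dotcV_ge0 (x - theta)) (ltW e0)).
      by move=> /le_trans; apply; rewrite ler_nat.
    have [_] := Fx n I; rewrite dotcV_add_scalar -/d => /le_trans; apply.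
    by rewrite lerD2l.
  move=> Sx n _; apply: (@quad_cone_le _ _ _ _ 0); rewrite ?invr_ge0//.
  by rewrite raddf0 addr0.
have cvgF : P (F n) @[n --> \oo] --> P (quad_cone theta S).
  rewrite -capF; apply: nonincreasing_cvg_mu.
  - by rewrite (le_lt_trans (probability_le1 _ _)) ?ltry//; exact: measurable_quad_cone.
  - by move=> n; exact: measurable_quad_cone.
  - by rewrite capF; exact: measurable_quad_cone.
  - move=> n m nm; apply/subsetPset/quad_cone_le.
    by rewrite lef_pV2 ?posrE// ler_nat.
have [n _ /(_ n (leqnn n)) Fn] := cvgF _ (open_nbhs_nbhs (conj (@open_ereal_lt_ereal R a) Sa)).
by exists n.+1%:R^-1; rewrite ?invr_gt0.
Qed.

(** * Semicontinuity and the singular case *)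

Lemma cone_depth_usc (R : realType) (k : nat) (hk : (0 < k)%N) (theta : 'cV[R]_k)
    (P : probability (borelcV R k) R) (V : 'M[R]_k) (a : \bar R) :
  (cone_depth theta P V < a)%E ->
  \forall W \near V, \tr W = k%:R -> (cone_depth theta P W < a)%E.
Proof.
move=> /ereal_inf_lt[_ [S /= SV <-]] /quad_cone_perturb[e e0 Sa].
have k0 : 0 < k%:R :> R by rewrite ltr0n.
have : \forall W \near V, - (e * k%:R) < \tr (S *m W).
  have cS : continuous (fun W : 'M[R]_k => \tr (S *m W)).
    by apply/continuous_mxtrace/continuous_mulmxl => i j; apply: coord_continuous.
  have := cvgr_gt _ (cS V); apply; rewrite SV oppr_lt0 mulr_gt0//.
apply: filterS => W SW trW; apply: le_lt_trans Sa.
(* The multiple of the identity makes the trace against [W] vanish. *)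
apply: (@le_trans _ _ (P (quad_cone theta (S + (- (\tr (S *m W) / k%:R))%:M)))).
  apply: ereal_inf_lbound; exists (S + (- (\tr (S *m W) / k%:R))%:M) => //=.
  by rewrite mulmxDl mul_scalar_mx raddfD/= linearZ/= trW mulNr divfK ?subrr ?gt_eqF.
rewrite le_measure ?inE//; try exact: measurable_quad_cone.
by apply: quad_cone_le; rewrite -mulNr ler_pdivrMr//; lra.
Qed.

Lemma cone_depth_singular (R : realType) (k : nat) (theta : 'cV[R]_k)
    (P : probability (borelcV R k) R) (V : 'M[R]_k) :
  psdmx V -> ~ posdefmx V -> (cone_depth theta P V <= hyperplane_mass theta P)%E.
Proof.
move=> [symV psdV] ndV.
have [v v0 vV] : exists2 v : 'cV[R]_k, v != 0 & dotcV v (V *m v) = 0.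
  apply: contrapT => nv; apply: ndV; split=> // x x0.
  rewrite lt_neqAle psdV andbT eq_sym; apply/eqP => xV.
  by apply: nv; exists x.
pose u := (enorm v)^-1 *: v.
have uV : dotcV u (V *m u) = 0.
  by rewrite -scalemxAr dotcVZl dotcVZr vV !mulr0.
apply: (@le_trans _ _ (P (quad_cone theta (- (u *m u^T))))).
  apply: ereal_inf_lbound; exists (- (u *m u^T)) => //=.
  rewrite mulNmx raddfN/= -mulmxA mxtrace_mulC /mxtrace big_ord1 -mulmxA.
  by rewrite -/(dotcV _ _) uV oppr0.
apply: (@le_trans _ _ (P [set x | dotcV u (x - theta) = 0])).
  rewrite le_measure ?inE//; [exact: measurable_quad_cone|exact: measurable_hyperplane|].
  move=> x [_]; rewrite mulNmx -mulmxA [u^T *m _]mx11_scalar mul_mx_scalar -/(dotcV _ _).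
  rewrite -scaleNr dotcVZr (dotcVC _ u) mulNr oppr_ge0 -expr2 => xu.
  by apply/eqP; rewrite -sqrf_eq0 eq_le xu sqr_ge0.
by apply: ereal_sup_ubound; exists u => //; exact: enorm_normalize.
Qed.

(** * The depth as an infimum over quadratic cones *)

(** [vec] is column-major and [mxvec] is row-major, so that [(mxvec M)^T] is the
    vectorization of [M^T]. *)
Lemma dotcV_vec (R : realType) (k : nat) (M C : 'M[R]_k) :
  dotcV (mxvec M)^T (vec C) = \tr (M *m C).
Proof.
rewrite dotcVE (reindex _ (curry_mxvec_bij _ _)) /= /mxtrace.
under [RHS]eq_bigr do rewrite mxE.
rewrite pair_bigA /=; apply: eq_bigr => -[i j] _ /=.
by rewrite !mxE !mxvecE mxE.
Qed.

Lemma dotcV_score_theta (R : realType) (k : nat) (theta : 'cV[R]_k) (V M : 'M[R]_k) :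
  dotcV (mxvec M)^T (scoreW theta V theta) = - (\tr M / k%:R).
Proof.
rewrite dotcV_vec /signU eqxx mul0mx sub0r mulmxN mul_mx_scalar raddfN/= mxtraceZ.
by rewrite mulrC.
Qed.

(** Subtracting [(tr M / k) I] from [M] absorbs the centring term of the score,
    since the sign vector has norm one. *)
Lemma score_ge0 (R : realType) (k : nat) (theta : 'cV[R]_k) (V M : 'M[R]_k) x :
  let B := invmx (sqrtmx V) in
  posdefmx V -> x != theta ->
  (0 <= dotcV (mxvec M)^T (scoreW theta V x)) =
  (0 <= dotcV (x - theta)
     (B *m (M - (\tr M / k%:R)%:M) *m B *m (x - theta))).
Proof.
move=> B /sqrtmxP[posB _] xt.
have Bu : sqrtmx V \in unitmx by exact: posdefmx_unit.
have symB : B^T = B by rewrite trmx_inv posB.1.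
set z := x - theta; pose y := B *m z.
have y0 : y != 0.
  apply/eqP => /(congr1 (mulmx (sqrtmx V))); rewrite mulmx0 mulKVmx// => /eqP.
  by rewrite subr_eq0 (negbTE xt).
pose n := enorm y; have n0 : 0 < n by exact: enorm_gt0.
rewrite dotcV_vec /signU (negbTE xt) -/z -/B -/y -/n; set U := n^-1 *: y.
have UU : dotcV U U = 1.
  by rewrite dotcVZl dotcVZr -sqr_enorm -/n mulrA -expr2 -exprMn mulVf ?expr1n ?gt_eqF.
rewrite mulmxBr raddfB/= mulmxA mxtrace_mulC mul_mx_scalar mxtraceZ [_^-1 * _]mulrC.
have -> : \tr (U^T *m (M *m U)) = dotcV U (M *m U) by rewrite /mxtrace big_ord1.
rewrite -[X in _ - X]mulr1 -UU -mulNr -dotcV_add_scalar raddfN/=.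
set N := M - _.
by rewrite dotcVZl -scalemxAr dotcVZr !pmulr_rge0 ?invr_gt0// -!mulmxA
  -{1}symB -dotcV_mulmxl.
Qed.

Lemma shape_depthE (R : realType) (k : nat) (hk : (0 < k)%N) (theta : 'cV[R]_k)
    (P : probability (borelcV R k) R) (V : 'M[R]_k) :
  posdefmx V -> shape_depth theta V P = cone_depth theta P V.
Proof.
move=> posV; have [posB BB] := sqrtmxP posV.
set B := sqrtmx V in posB BB.
have Bu : B \in unitmx by exact: posdefmx_unit.
have k0 : 0 < k%:R :> R by rewrite ltr0n.
apply/eqP; rewrite eq_le; apply/andP; split.
  apply/ereal_infP => _ [S /= SV <-]; apply: ge_ereal_inf.
  (* The identity gives [M] a positive trace, which removes [theta] from the
     half-space without changing its other points. *)
  pose M := B *m S *m B + 1%:M.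
  have trBSB : \tr (B *m S *m B) = 0 by rewrite -mulmxA mxtrace_mulC -mulmxA BB.
  have trM : \tr M = k%:R by rewrite raddfD/= trBSB add0r mxtrace1.
  pose m := (mxvec M)^T.
  have m0 : m != 0.
    apply/eqP => /(congr1 trmx); rewrite trmxK trmx0 => /eqP.
    rewrite mxvec_eq0 => /eqP M0; move: trM; rewrite M0 mxtrace0 => /esym/eqP.
    by rewrite gt_eqF.
  have em0 := enorm_gt0 m0.
  exists (P (quad_cone theta S)) => //.
  exists ((enorm m)^-1 *: m); first exact: enorm_normalize.
  congr (P _); apply/seteqP; split=> x /=; rewrite dotcVZl pmulr_rge0 ?invr_gt0//.
    have [->|xt] := eqVneq x theta.
      by rewrite dotcV_score_theta trM divff ?gt_eqF// lerNr oppr0 ler10.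
    by rewrite score_ge0// trM divff ?gt_eqF// addrK -/B -!mulmxA mulKmx// mulKVmx.
  move=> [xt]; rewrite score_ge0// trM divff ?gt_eqF// addrK -/B.
  by rewrite -!mulmxA mulKmx// mulKVmx.
apply/ereal_infP => _ [u _ <-]; pose M := vec_mx u^T.
have uE : u = (mxvec M)^T by rewrite vec_mxK trmxK.
pose S := invmx B *m (M - (\tr M / k%:R)%:M) *m invmx B.
have scoreS x : x != theta ->
    (0 <= dotcV u (scoreW theta V x)) = (0 <= dotcV (x - theta) (S *m (x - theta))).
  by move=> xt; rewrite {1}uE score_ge0.
apply: ge_ereal_inf; exists (P (quad_cone theta S)).
  exists S => //=.
  rewrite /S mxtrace_mulC -BB !mulmxA mulmxK// mxtrace_mulC mulKmx//.
  by rewrite raddfB/= mxtrace_scalar -[X in _ - X]mulr_natr divfK ?subrr// gt_eqF.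
rewrite le_measure ?inE//; first exact: measurable_quad_cone.
  (* The point [theta] may or may not belong to the half-space. *)
  rewrite (_ : [set _ | _] = quad_cone theta S `|`
      (if 0 <= dotcV u (scoreW theta V theta) then [set theta] else set0)).
    apply: (@measurableU _ (borelcV R k)); first exact: measurable_quad_cone.
    case: ifP => _; last exact: (@measurable0 _ (borelcV R k)).
    by apply: (@borelcV_closed_measurable R k); exact: closed_singleton.
  apply/seteqP; split=> x /=.
    have [->|xt] := eqVneq x theta; first by move=> ->; right.
    by rewrite (scoreS _ xt) => Sx; left; exact: (conj xt Sx).
  case=> [[xt Sx]|]; first by rewrite (scoreS _ xt).
  by case: ifP => [ut ->|_ []].
by move=> x [xt]; rewrite -scoreS.
Qed.

(** * Existence of a deepest shape *)

Lemma shapemx_psd (R : realType) (k : nat) (V : 'M[R]_k) :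
  shapemx V -> psdshapemx V.
Proof.
move=> [[symV posV] trV]; split=> //; split=> // x.
by have [->|/posV/ltW//] := eqVneq x 0; rewrite mulmx0 dotcV0r.
Qed.

Lemma shapemx1 (R : realType) (k : nat) : shapemx (1%:M : 'M[R]_k).
Proof.
split; last by rewrite mxtrace1.
by split=> [|x x0]; [rewrite trmx1|rewrite mul1mx dotcV_gt0].
Qed.

Lemma deepest_shape_exists (R : realType) (k : nat) (hk : (0 < k)%N)
    (P : probability (borelcV R k) R) (theta : 'cV[R]_k) :
  depth_region theta (hyperplane_mass theta P) P !=set0 ->
  exists Vstar : 'M[R]_k, deepest_shape theta P Vstar.
Proof.
move=> [V0 [shV0 V0t]].
have [|W [psdW trW] maxW] := usc_compact_max (f := cone_depth theta P)
    (@compact_psdshapemx R k) (ex_intro _ V0 (shapemx_psd shV0)).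
  move=> V a _ /(cone_depth_usc hk); apply: filterS => W + [_ trW]; exact.
have depth_le V : shapemx V -> (shape_depth theta V P <= cone_depth theta P W)%E.
  move=> shV; rewrite shape_depthE//; last by case: shV.
  exact/maxW/shapemx_psd.
have [posW|sgW] := pselect (posdefmx W).
  exists W; split; first by split.
  by move=> V /depth_le; rewrite (shape_depthE hk theta P posW).
exists V0; split; first exact: shV0.
move=> V /depth_le /le_trans; apply.
exact: le_trans (cone_depth_singular _ _ psdW sgW) V0t.
Qed.

Theorem theorem3p3 (R : realType) (k : nat) (hk : (0 < k)%N)
    (P : probability (borelcV R k) R) (theta : 'cV[R]_k) :
  (depth_region theta (hyperplane_mass theta P) P !=set0 ->
     exists Vstar : 'M[R]_k, deepest_shape theta P Vstar) /\
  (smooth_at theta P ->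
     exists Vstar : 'M[R]_k, deepest_shape theta P Vstar).
Proof.
have exists_deepest := deepest_shape_exists hk (P := P) (theta := theta).
split=> // smooth; apply: exists_deepest; exists 1%:M; split; first exact: shapemx1.
by rewrite smooth; apply/ereal_infP => _ [u _ <-].
Qed.
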